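(* Let $d\ge 1$, let $\boldsymbol{s}_k,\boldsymbol{y}_k\in\mathbb{R}^d$, let $p_k>0$ and $\rho>0$ be scalars, and let $\boldsymbol{H}_k\in\mathbb{R}^{d\times d}$ be symmetric. Let $\boldsymbol{W}\in\mathbb{R}^{d\times d}$ be any positive-definite matrix such that $\boldsymbol{W}\boldsymbol{s}_k=\boldsymbol{y}_k$. Define the S-BFGS update $\boldsymbol{H}_{k+1}$ as the solution of the minimization problem $$\boldsymbol{H}_{k+1}=\underset{\boldsymbol{H}\in\mathbb{R}^{d\times d}}{\arg\min}\left(\frac{1}{\rho}\left\|\boldsymbol{s}_k-\boldsymbol{H}\boldsymbol{y}_k\right\|_{\boldsymbol{W}_l}^2+\frac12\left\|\boldsymbol{H}-\boldsymbol{H}_k\right\|_{F,\boldsymbol{W}_{pr}}^2\right)\quad\text{subject to }\boldsymbol{H}=\boldsymbol{H}^\top,$$ with $\boldsymbol{W}_{pr}=\boldsymbol{W}$ and $\boldsymbol{W}_l=p_k\boldsymbol{W}$. Then $$\boldsymbol{H}_{k+1}=\boldsymbol{H}_k+\frac{1+\frac{\boldsymbol{y}_k^\top\boldsymbol{H}_k\boldsymbol{y}_k}{\boldsymbol{s}_k^\top\boldsymbol{y}_k+\frac{\rho}{p_k}}}{\boldsymbol{s}_k^\top\boldsymbol{y}_k+\frac{\rho}{2p_k}}\,\boldsymbol{s}_k\boldsymbol{s}_k^\top-\frac{1}{\boldsymbol{s}_k^\top\boldsymbol{y}_k+\frac{\rho}{p_k}}\left(\boldsymbol{H}_k\bolds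ymbol{y}_k\boldsymbol{s}_k^\top+\boldsymbol{s}_k\boldsymbol{y}_k^\top\boldsymbol{H}_k\right).$$
   Context: Positive-definite matrices are understood to be symmetric. For a positive-definite matrix $\boldsymbol{W}$, $\sqrt{\boldsymbol{W}}$ is its square root, $\|\boldsymbol{v}\|_{\boldsymbol{W}}^2=\|\sqrt{\boldsymbol{W}}\boldsymbol{v}\|^2$ (Euclidean norm) for $\boldsymbol{v}\in\mathbb{R}^d$, and $\|\boldsymbol{A}\|_{F,\boldsymbol{W}}^2=\|\sqrt{\boldsymbol{W}}\boldsymbol{A}\sqrt{\boldsymbol{W}}\|_F^2$ (Frobenius norm) for $\boldsymbol{A}\in\mathbb{R}^{d\times d}$. *)

(* Defs.v *)
From HB Require Import structures.
From mathcomp Require Import all_boot all_order all_algebra.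
From mathcomp Require Import boolp classical_sets reals.

Set Implicit Arguments.
Unset Strict Implicit.
Unset Printing Implicit Defensive.

Import Order.TTheory GRing.Theory Num.Theory.
Local Open Scope classical_set_scope.
Local Open Scope ring_scope.

Definition posdefmx (R : realType) (n : nat) (W : 'M[R]_n) : Prop :=
  W = W^T /\ forall v : 'cV[R]_n, v != 0 -> 0 < (v^T *m W *m v) 0 0.

(* A positive-definite matrix has exactly one positive-definite square root,
   so on such matrices the choice below is uniquely determined; the default
   value 0 is only returned when there is no positive-definite square root. *)
Definition sqrtmx (R : realType) (n : nat) (W : 'M[R]_n) : 'M[R]_n :=
  xget 0 [set S : 'M[R]_n | posdefmx S /\ S *m S = W].

(* The library's norm `|_| on matrices is the sup norm. *)
Definition enorm (R : realType) (n : nat) (v : 'cV[R]_n) : R :=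
  Num.sqrt (\sum_(i < n) v i 0 ^+ 2).

Definition fnorm (R : realType) (m n : nat) (A : 'M[R]_(m, n)) : R :=
  Num.sqrt (\sum_(i < m) \sum_(j < n) A i j ^+ 2).

Definition wenorm (R : realType) (n : nat) (W : 'M[R]_n) (v : 'cV[R]_n) : R :=
  enorm (sqrtmx W *m v).

Definition wfnorm (R : realType) (n : nat) (W A : 'M[R]_n) : R :=
  fnorm (sqrtmx W *m A *m sqrtmx W).

Definition argmin (R : realType) (T : Type) (f : T -> R) (C : set T) : set T :=
  [set x | C x /\ forall y, C y -> f x <= f y].

Definition sbfgs_objective (R : realType) (d : nat) (sk yk : 'cV[R]_d)
    (rho : R) (Hk Wl Wpr H : 'M[R]_d) : R :=
  1 / rho * wenorm Wl (sk - H *m yk) ^+ 2 + 1 / 2 * wfnorm Wpr (H - Hk) ^+ 2.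

(* Main.v *)
(* On symmetric matrices the objective is a quadratic function; expanded around
   the claimed minimizer [Hs], its linear part in a symmetric increment [D] is
   [- (2 * pk / rho) * (D *m yk)^T *m W *m (sk - Hs *m yk)
    + \tr (D *m W *m (Hs - Hk) *m W)].
   Since [W *m sk = yk], both terms are combinations of [yk^T *m D *m yk] and
   [yk^T *m D *m W *m Hk *m yk], and the two coefficients of the update formula
   are exactly those that cancel them. The quadratic part is positive definite,
   so [Hs] is the unique minimizer. *)
Require Import Defs.
From HB Require Import structures.
From mathcomp Require Import all_boot all_order all_algebra.
From mathcomp Require Import boolp classical_sets reals.
From mathcomp Require Import ring lra.
From mathcomp Require complex.

Set Implicit Arguments.
Unset Strict Implicit.
Unset Printing Implicit Defensive.

Import Order.TTheory GRing.Theory Num.Theory.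
Local Open Scope classical_set_scope.
Local Open Scope ring_scope.

(** * Existence of square roots of positive-definite matrices *)

(** Newton's scheme: a multiple of the product vanishing on [s] corrects the value at a new node. It
    lets a root of a matrix be taken as a polynomial in it. *)
Lemma poly_interpolation (F : fieldType) (f : F -> F) (s : seq F) :
  exists q : {poly F}, forall x, x \in s -> q.[x] = f x.
Proof.
elim: s => [|a s [q qP]]; first by exists 0.
have [a_s|a_s] := boolP (a \in s).
  by exists q => x; rewrite inE => /predU1P[->|]; exact: qP.
pose r := \prod_(b <- s) ('X - b%:P).
have ra0 : r.[a] != 0 by rewrite -rootE root_prod_XsubC.
exists (q + ((f a - q.[a]) / r.[a]) *: r) => x; rewrite inE !hornerE.
case/predU1P => [->|xs]; first by rewrite divfK // addrC subrK.
have /rootP-> : root r x by rewrite root_prod_XsubC.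
by rewrite mulr0 addr0 qP.
Qed.

Lemma trmx_horner (F : comNzRingType) (n : nat) (A : 'M[F]_n.+1) (q : {poly F}) :
  (horner_mx A q)^T = horner_mx A^T q.
Proof.
elim/poly_ind: q => [|q c IHq]; first by rewrite !rmorph0 trmx0.
rewrite !rmorphD !rmorphM /= !horner_mx_X !horner_mx_C linearD /= tr_scalar_mx.
rewrite -[horner_mx A q * A]/(horner_mx A q *m A) trmx_mul IHq.
by congr (_ + _); apply/comm_mx_horner.
Qed.

Lemma mulmx_trE (R : realType) (n : nat) (v : 'cV[R]_n) :
  (v^T *m v) 0 0 = \sum_(i < n) v i 0 ^+ 2.
Proof. by rewrite mxE; apply: eq_bigr => i _; rewrite mxE expr2. Qed.

Lemma mulmx_tr_gt0 (R : realType) (n : nat) (v : 'cV[R]_n) :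
  v != 0 -> 0 < (v^T *m v) 0 0.
Proof.
move=> v0; rewrite mulmx_trE lt0r sumr_ge0 ?andbT => [|i _]; last exact: sqr_ge0.
apply: contraNneq v0 => vv0; apply/eqP/colP => i; rewrite mxE.
apply/eqP; rewrite -sqrf_eq0; apply/eqP; move: i (isT).
by apply: (psumr_eq0P _ vv0) => j _; exact: sqr_ge0.
Qed.

Section RealSpectral.
Import complex.
Local Notation toC := (real_complex _).

(** Over the complex numbers [A] is Hermitian, hence unitarily diagonalizable with real eigenvalues,
    and [q] acts on the diagonal entrywise. The real statement confines the complex detour to this
    proof. *)
Lemma sym_annihilator (R : rcfType) (n : nat) (A : 'M[R]_n.+1) : A = A^T ->
  exists2 s : seq R, {in s, forall a, eigenvalue A a} &
    forall q : {poly R}, {in s, forall a, root q a} -> horner_mx A q = 0.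
Proof.
move=> symA; pose AC := map_mx toC A.
have hermA : AC \is hermsymmx.
  apply: realsym_hermsym.
    by apply/is_hermitianmxP; rewrite scale1r map_mx_id // map_trmx -symA.
  by apply/mxOverP => i j; rewrite mxE complex_real.
pose P := spectralmx AC; pose d := spectral_diag AC.
have Punit : P \in unitmx by exact: spectral_unit.
have defA : AC = invmx P *m diag_mx d *m P.
  exact/orthomx_spectralP/hermitian_normalmx.
have dR i : toC (Re (d 0 i)) = d 0 i.
  by apply: RRe_real; apply/mxOverP/hermitian_spectral_diag_real.
exists [seq Re (d 0 i) | i : 'I_n.+1] => [_ /mapP[i _ ->]|q rootq].
  rewrite -(eigenvalue_map toC) -/AC [f in eigenvalue _ f]dR.
  apply/eigenvalueP; exists (row i P).
    rewrite -row_mul {1}defA -!mulmxA mulKVmx // row_mul.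
    by rewrite row_diag_mx -scalemxAl -rowE.
  (* A zero row of the invertible [P] would make row [i] of [P *m Q = 1] zero. *)
  have /row_freeP[Q /(congr1 (row i))] : row_free P by rewrite row_free_unit.
  rewrite row_mul => PQ; apply/eqP => rowP0; move: PQ.
  rewrite rowP0 mul0mx => /rowP/(_ i).
  by rewrite !mxE eqxx => /eqP; rewrite eq_sym oner_eq0.
apply: (map_mx_inj (f := toC)); rewrite map_horner_mx -/AC defA.
rewrite horner_mx_uconjC // horner_mx_diag map_mx0.
suff -> : map_mx (horner (map_poly toC q)) d = 0.
  by rewrite linear0 mulmx0 mul0mx.
apply/rowP => i; rewrite !mxE -dR horner_map.
have /rootP-> : root q (Re (d 0 i)) by apply/rootq/map_f; rewrite mem_enum.
exact: rmorph0.
Qed.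

End RealSpectral.

Lemma posdefmx_eigenvalue_gt0 (R : realType) (n : nat) (W : 'M[R]_n) (a : R) :
  posdefmx W -> eigenvalue W a -> 0 < a.
Proof.
move=> [_ Wpos] /eigenvalueP[v vW v0].
have vT0 : v^T != 0 by rewrite -trmx0 (inj_eq trmx_inj).
have := Wpos _ vT0; rewrite trmxK vW -scalemxAl mxE.
by rewrite pmulr_lgt0 // -{1}(trmxK v) mulmx_tr_gt0.
Qed.

Lemma posdefmx_unit (R : realType) (n : nat) (W : 'M[R]_n) :
  posdefmx W -> W \in unitmx.
Proof.
move=> posW; rewrite -row_free_unit -kermx_eq0.
have /negPf : ~~ eigenvalue W 0.
  by apply/negP => /(posdefmx_eigenvalue_gt0 posW); rewrite ltxx.
by rewrite /eigenvalue /eigenspace raddf0 subr0 => /negbT/negPn.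
Qed.

Lemma posdefmxZ (R : realType) (n : nat) (W : 'M[R]_n) (a : R) :
  0 < a -> posdefmx W -> posdefmx (a *: W).
Proof.
move=> a0 [symW Wpos]; split; first by rewrite linearZ /= -symW.
by move=> v v0; rewrite -scalemxAr -scalemxAl mxE mulr_gt0 // Wpos.
Qed.

(* With [q] interpolating the fourth root on the spectrum of [W], the matrix
   [q(W) ^ 2] is a square root of [W]; being a square, it is positive. *)
Lemma posdefmx_sqrt (R : realType) (n : nat) (W : 'M[R]_n) :
  posdefmx W -> exists S : 'M[R]_n, posdefmx S /\ S *m S = W.
Proof.
case: n W => [|n] W posW.
  (* Dimension 0 is separate because [horner_mx] needs a size of the form [n.+1]. *)
  by exists W; split=> //; rewrite [W]flatmx0 mul0mx.
have [symW Wpos] := posW.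
have [s eigs annW] := sym_annihilator symW.
have [q qP] := poly_interpolation (fun x => Num.sqrt (Num.sqrt x)) s.
pose Q := horner_mx W q.
have symQ : Q^T = Q by rewrite trmx_horner -symW.
have Q4 : Q ^+ 4 = W.
  (* The polynomial [q ^+ 4 - 'X] vanishes on the spectrum, so it annihilates [W]. *)
  apply/eqP; rewrite -subr_eq0 -[X in _ - X](horner_mx_X W) -rmorphXn -rmorphB /=.
  apply/eqP/annW => a sa; rewrite rootE !hornerE qP // (exprM _ 2 2).
  rewrite !sqr_sqrtr ?sqrtr_ge0 ?subrr // ltW //.
  exact/posdefmx_eigenvalue_gt0/eigs.
(* Invertibility makes [Q ^+ 2] definite, not merely semidefinite. *)
have Qunit : Q \in unitmx.
  have := posdefmx_unit posW.
  by rewrite -Q4 -!/(_ \is a GRing.unit) unitrX_pos.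
exists (Q ^+ 2); split; last by rewrite -[LHS]/(Q ^+ 2 * Q ^+ 2) -exprD.
split; first by rewrite expr2 -[Q * Q]/(Q *m Q) trmx_mul symQ.
move=> v v0; rewrite expr2 -[Q * Q]/(Q *m Q) mulmxA -{1}symQ -trmx_mul -mulmxA.
apply: mulmx_tr_gt0; apply: contra v0 => /eqP/(congr1 (mulmx (invmx Q))).
by rewrite mulKmx // mulmx0 => ->.
Qed.

(** Existence of a root rules out the default value of [xget]. *)
Lemma sqrtmxP (R : realType) (n : nat) (W : 'M[R]_n) :
  posdefmx W -> posdefmx (sqrtmx W) /\ sqrtmx W *m sqrtmx W = W.
Proof.
move=> /posdefmx_sqrt[S SP].
by apply: (@xgetPex _ 0 [set S | posdefmx S /\ S *m S = W]); exists S.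
Qed.

(** * Weighted norms as quadratic forms and traces *)

Lemma wenorm_sqr (R : realType) (n : nat) (W : 'M[R]_n) (v : 'cV[R]_n) :
  posdefmx W -> wenorm W v ^+ 2 = (v^T *m W *m v) 0 0.
Proof.
move=> /sqrtmxP[[symS _] SS]; rewrite /wenorm /enorm sqr_sqrtr; last first.
  by apply: sumr_ge0 => i _; exact: sqr_ge0.
by rewrite -mulmx_trE trmx_mul -symS !mulmxA -(mulmxA v^T (sqrtmx W)) SS.
Qed.

Lemma mxtrace_mulmx_tr (R : realType) (m n : nat) (A : 'M[R]_(m, n)) :
  \tr (A *m A^T) = \sum_(i < m) \sum_(j < n) A i j ^+ 2.
Proof.
apply: eq_bigr => i _; rewrite mxE.
by apply: eq_bigr => j _; rewrite mxE expr2.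
Qed.

(** Cyclicity of the trace brings the outer roots together, so that every pair merges into [W]. *)
Lemma wfnorm_sqr (R : realType) (n : nat) (W A : 'M[R]_n) :
  posdefmx W -> wfnorm W A ^+ 2 = \tr (A *m W *m A^T *m W).
Proof.
move=> /sqrtmxP[[symS _] SS]; rewrite /wfnorm /fnorm sqr_sqrtr; last first.
  by apply: sumr_ge0 => i _; apply: sumr_ge0 => j _; exact: sqr_ge0.
rewrite -mxtrace_mulmx_tr !trmx_mul -symS !mulmxA mxtrace_mulC !mulmxA SS.
by rewrite -(mulmxA _ (sqrtmx W) (sqrtmx W)) SS [RHS]mxtrace_mulC !mulmxA.
Qed.

Lemma wfnorm_eq0 (R : realType) (n : nat) (W A : 'M[R]_n) :
  posdefmx W -> wfnorm W A = 0 -> A = 0.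
Proof.
move=> /sqrtmxP[/posdefmx_unit Sunit _] /eqP; rewrite sqrtr_eq0 => sum_le0.
suff SAS0 : sqrtmx W *m A *m sqrtmx W = 0.
  by rewrite -(mulKmx Sunit A) -(mulmxK Sunit (_ *m A)) SAS0 mul0mx mulmx0.
apply/matrixP => i j; rewrite [RHS]mxE; apply/eqP; rewrite -sqrf_eq0 eq_le.
rewrite sqr_ge0 andbT; apply: le_trans sum_le0.
rewrite (bigD1 i) //= (bigD1 j) //= -addrA lerDl addr_ge0 //.
  by apply: sumr_ge0 => k _; exact: sqr_ge0.
by apply: sumr_ge0 => k _; apply: sumr_ge0 => l _; exact: sqr_ge0.
Qed.

(** * Algebra of bilinear forms and traces *)

Lemma mxtrace_mul_rank1 (R : comNzRingType) (n : nat) (D : 'M[R]_n)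
    (u v : 'cV[R]_n) :
  \tr (D *m (u *m v^T)) = (v^T *m D *m u) 0 0.
Proof. by rewrite mulmxA mxtrace_mulC -trace_mx11 mulmxA. Qed.

Lemma trmxB_sym (R : comNzRingType) (n : nat) (A B : 'M[R]_n) :
  A = A^T -> B = B^T -> A - B = (A - B)^T.
Proof. by move=> symA symB; rewrite linearB /= -symA -symB. Qed.

Lemma bilinear_symC (R : comNzRingType) (n : nat) (D : 'M[R]_n)
    (u v : 'cV[R]_n) :
  D = D^T -> (u^T *m D *m v) 0 0 = (v^T *m D *m u) 0 0.
Proof.
move=> symD; rewrite -[LHS]trace_mx11 -mxtrace_tr trace_mx11.
by rewrite !trmx_mul trmxK -symD mulmxA.
Qed.

Lemma quadraticB (R : comNzRingType) (n : nat) (W : 'M[R]_n) (u v : 'cV[R]_n) :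
  W = W^T ->
  ((u - v)^T *m W *m (u - v)) 0 0
  = (u^T *m W *m u) 0 0 - 2 * (v^T *m W *m u) 0 0 + (v^T *m W *m v) 0 0.
Proof.
move=> symW; rewrite [(u - v)^T]linearB /= !mulmxBl !mulmxBr.
rewrite -!trace_mx11 !linearB /= !trace_mx11 (bilinear_symC u v symW); ring.
Qed.

Lemma mxtrace_quadraticD (R : comNzRingType) (n : nat) (W A B : 'M[R]_n) :
  W = W^T ->
  \tr ((A + B) *m W *m (A + B)^T *m W)
  = \tr (A *m W *m A^T *m W) + 2 * \tr (B *m W *m A^T *m W)
    + \tr (B *m W *m B^T *m W).
Proof.
move=> symW; rewrite [(A + B)^T]linearD /= !(mulmxDl, mulmxDr) !linearD /=.
(* The two cross terms agree: transpose, then rotate the trace. *)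
have -> : \tr (A *m W *m B^T *m W) = \tr (B *m W *m A^T *m W).
  rewrite -mxtrace_tr !trmx_mul trmxK -symW.
  by rewrite mxtrace_mulC !mulmxA.
by ring.
Qed.

Lemma mul_col_mx11 (R : comNzRingType) (m : nat) (u : 'cV[R]_m) (c : 'M[R]_1) :
  u *m c = c 0 0 *: u.
Proof. by rewrite {1}[c]mx11_scalar mul_mx_scalar. Qed.

Theorem proposition1 (R : realType) (d : nat) (hd : (1 <= d)%N)
    (sk yk : 'cV[R]_d) (pk rho : R) (hpk : 0 < pk) (hrho : 0 < rho)
    (Hk : 'M[R]_d) (hHk : Hk = Hk^T)
    (W : 'M[R]_d) (hW : posdefmx W) (hWs : W *m sk = yk) :
  argmin (sbfgs_objective sk yk rho Hk (pk *: W) W)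
         [set H : 'M[R]_d | H = H^T]
  = [set Hk
      + ((1 + (yk^T *m Hk *m yk) 0 0 / ((sk^T *m yk) 0 0 + rho / pk))
         / ((sk^T *m yk) 0 0 + rho / (2 * pk))) *: (sk *m sk^T)
      - (1 / ((sk^T *m yk) 0 0 + rho / pk))
          *: (Hk *m yk *m sk^T + sk *m yk^T *m Hk)].
Proof.
have [symW Wpos] := hW.
set sigma := (sk^T *m yk) 0 0; set h := (yk^T *m Hk *m yk) 0 0.
set a := _ / (sigma + rho / (2 * pk)); set b := 1 / _.
set Hs := _ - _.
(* [sigma] is the form of [W] at [sk], possibly zero; the positive [rho] terms then keep both
   denominators positive. *)
have sigma0 : 0 <= sigma.
  rewrite /sigma -hWs mulmxA; have [->|s0] := eqVneq sk 0.
    by rewrite mulmx0 mxE.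
  exact/ltW/Wpos.
have symHs : Hs = Hs^T.
  rewrite /Hs [(_ - _)^T]linearB /= ![(_ + _)^T]linearD /= ![(_ *: _)^T]linearZ /=.
  rewrite [(_ + _)^T]linearD /= !trmx_mul !trmxK -hHk.
  by rewrite -!mulmxA [X in _ - _ *: X]addrC.
(* Together, [yk] and [g] express both the weighted residual and the weighted increment. *)
pose g := W *m Hk *m yk.
have sW : sk^T *m W = yk^T by rewrite -hWs trmx_mul -symW.
have gT : g^T = yk^T *m Hk *m W by rewrite !trmx_mul -hHk -symW mulmxA.
have residual : W *m (sk - Hs *m yk)
    = (1 - a * sigma + b * h) *: yk + (b * sigma - 1) *: g.
  rewrite /Hs mulmxBl mulmxDl -!scalemxAl mulmxDl.
  rewrite -!mulmxA (mulmxA yk^T) !mul_col_mx11 -/sigma -/h.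
  rewrite !mulmxBr mulmxDr -!scalemxAr mulmxDr -!scalemxAr.
  rewrite hWs mulmxA -/g.
  by apply/matrixP => i j; rewrite !mxE; ring.
have increment : W *m (Hs - Hk) *m W
    = a *: (yk *m yk^T) - b *: (g *m yk^T + yk *m g^T).
  rewrite /Hs addrAC [Hk + _]addrC addrK.
  rewrite mulmxBr mulmxBl -!scalemxAr -!scalemxAl mulmxDr mulmxDl.
  by rewrite !mulmxA hWs gT -!(mulmxA _ _ W) !sW /g !mulmxA.
(* Stationarity in exact form: the linear term in [D] is absent, and only the quadratic part
   remains. *)
have expand (D : 'M[R]_d) : D = D^T ->
    sbfgs_objective sk yk rho Hk (pk *: W) W (Hs + D)
    = sbfgs_objective sk yk rho Hk (pk *: W) W Hs
      + (1 / rho * wenorm (pk *: W) (D *m yk) ^+ 2 + 1 / 2 * wfnorm W D ^+ 2).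
  move=> symD; rewrite /sbfgs_objective.
  have symE : (Hs - Hk)^T = Hs - Hk by rewrite -trmxB_sym.
  rewrite mulmxDl opprD addrA -[Hs + D - Hk]addrAC.
  rewrite !(wenorm_sqr _ (posdefmxZ hpk hW)) !(wfnorm_sqr _ hW).
  rewrite quadraticB; last by rewrite linearZ /= -symW.
  rewrite mxtrace_quadraticD // symE.
  (* The symmetry of [D] merges the two mixed terms, whence the factor 2 on [b]. *)
  have -> : \tr (D *m W *m (Hs - Hk) *m W)
      = a * (yk^T *m D *m yk) 0 0 - 2 * b * (yk^T *m D *m g) 0 0.
    rewrite -[D *m W *m _]mulmxA -[D *m _ *m W]mulmxA increment.
    rewrite mulmxBr -!scalemxAr mulmxDr linearB /= !linearZ /= linearD /=.
    rewrite !mxtrace_mul_rank1 (bilinear_symC g yk symD).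
    by ring.
  have -> : ((D *m yk)^T *m (pk *: W) *m (sk - Hs *m yk)) 0 0
      = pk * ((1 - a * sigma + b * h) * (yk^T *m D *m yk) 0 0
              + (b * sigma - 1) * (yk^T *m D *m g) 0 0).
    rewrite -scalemxAr -scalemxAl -(mulmxA _ W) residual trmx_mul -symD.
    by rewrite mulmxDr -!scalemxAr -!trace_mx11 !(linearB, linearD, linearZ) /= !trace_mx11.
  have bE : b * (sigma + rho / pk) = 1.
    by rewrite /b mul1r mulVf // gt_eqF // ltr_wpDl // divr_gt0.
  have aE : a * (sigma + rho / (2 * pk)) = 1 + b * h.
    rewrite /a divfK ?[h / _]mulrC ?/b ?mul1r //.
    by rewrite gt_eqF // ltr_wpDl // divr_gt0 // mulr_gt0.
  (* Clearing denominators in [a] and [b] rewrites the residual coefficients; times [- 2 * pk / rho]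
     they become [- a] and [2 * b], opposite to those of the trace term. *)
  have bE' : b * sigma - 1 = - (b * rho / pk) by rewrite -bE; ring.
  have aE' : 1 - a * sigma + b * h = a * rho / (2 * pk).
    by rewrite addrAC -aE; ring.
  rewrite bE' aE'; field.
  by rewrite !gt_eqF.
have excess_ge0 (D : 'M[R]_d) : 0 <=
  1 / rho * wenorm (pk *: W) (D *m yk) ^+ 2 + 1 / 2 * wfnorm W D ^+ 2.
  by rewrite addr_ge0 // mulr_ge0 ?sqr_ge0 // divr_ge0 // ltW.
apply/seteqP; split => [H [/= symH minH]|_ ->] /=; last first.
  split=> // H symH; rewrite -(subrK Hs H) addrC expand ?lerDl //.
  exact: trmxB_sym.
have symD : H - Hs = (H - Hs)^T by exact: trmxB_sym.
(* Comparing a minimizer [H] with [Hs] makes the excess nonpositive; as both its terms are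
   nonnegative, [wfnorm W (H - Hs)] vanishes. *)
have := minH _ symHs; rewrite -{1}(subrK Hs H) [_ + Hs]addrC expand //.
rewrite gerDl => le0; apply/eqP; rewrite -subr_eq0; apply/eqP.
apply: (wfnorm_eq0 hW); apply/eqP; rewrite -sqrf_eq0 eq_le sqr_ge0 andbT.
have := sqr_ge0 (wenorm (pk *: W) ((H - Hs) *m yk)).
have r0 : 0 <= 1 / rho by rewrite divr_ge0 // ltW.
by move=> /(mulr_ge0 r0); lra.
Qed.
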